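(* Let $m\in\mathbb{N}$, $L\in\mathbb{R}_{\ge 0}$, and for $i\in\{1,\dots,m\}$, $u\in\mathcal{U}$, $\theta\in\mathbb{R}_{>0}$ consider the interval $$[\mathcal{I}_i^{m,L}u](\theta)=\bigcap_{\hat N\in\mathbb{R}_{\ge 0}}\left[\ \sup_{\substack{h\in\mathcal{F}_L^m\\ \|h-u\|_{\infty,\theta}\le \hat N}}h^{(i)}(\theta)-\bar g^{m,2L}_{\hat N,i}(\theta),\ \inf_{\substack{h\in\mathcal{F}_L^m\\ \|h-u\|_{\infty,\theta}\le \hat N}}h^{(i)}(\theta)+\bar g^{m,2L}_{\hat N,i}(\theta)\right],$$ where for each $\hat N$ for which no $h\in\mathcal{F}_L^m$ satisfies $\|h-u\|_{\infty,\theta}\le\hat N$ the corresponding interval is understood to be $(-\infty,\infty)$. Then: a) the interval $[\mathcal{I}_i^{m,L}u](\theta)$ is nonempty and bounded for all $u\in\mathcal{U}$, all $\theta\in\mathbb{R}_{>0}$ and all $i\in\{1,\dots,m\}$; b) a causal differentiator $\mathcal{D}$ of order $m$ is deterministically optimal over $\mathcal{F}_L^m$ if and only if $[\mathcal{D}_iu](t)\in[\mathcal{I}_i^{m,L}u](t)$ for all $u\in\mathcal{U}$, all $t>0$ and all $i\in\{1,\dots,m\}$; c) the differentiator $\mathcal{D}$ of order $m$ defined by $$[\mathcal{D}_iu](t)=\begin{cases}\dfrac{\inf[\mathcal{I}_i^{m,L}u](t)+\sup[\mathcal{I}_i^{m,L}u](t)}{2}&\text{if }t>0,\\[1ex] 0&\text{otherwise}\end{cases}$$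 is causal, deterministically optimal over $\mathcal{F}_L^m$, and robust almost from the beginning over $\mathcal{U}$.
   Context: For $m\in\mathbb{N}_0$ and $L,N\ge 0$: $\mathcal{F}^m$ is the set of functions $f:\mathbb{R}_{\ge 0}\to\mathbb{R}$ that are $m$ times continuously differentiable with $f^{(m)}$ Lipschitz continuous; $\mathcal{F}_L^m=\{f\in\mathcal{F}^m: |f^{(m+1)}(t)|\le L\text{ a.e. on }\mathbb{R}_{\ge0}\}$; $\mathcal{E}_N=\{\eta:\mathbb{R}_{\ge0}\to\mathbb{R}: |\eta(t)|\le N\text{ for all }t\ge0\}$; $\mathcal{F}_L^m+\mathcal{E}_N=\{f+\eta: f\in\mathcal{F}_L^m,\eta\in\mathcal{E}_N\}$; and $\mathcal{U}=\bigcup_{m\in\mathbb{N}_0,\,L,N\ge0}(\mathcal{F}_L^m+\mathcal{E}_N)$. Also $f^{(0)}=f$, derivatives at $0$ are one-sided, and $\|u\|_{\infty,\theta}=\sup_{\tau\in[0,\theta]}|u(\tau)|$. A differentiator of order $m$ is an operator $\mathcal{D}:\mathcal{U}\to(\mathbb{R}_{\ge0}\to\mathbb{R}^m)$, with components $\mathcal{D}_1,\dots,\mathcal{D}_m$. It is causal if for all $t\ge0$, $[\mathcal{D}u_1](t)=[\mathcal{D}u_2](t)$ whenever $u_1=u_2$ on $[0,t]$. Worst-case error over a signal class $\mathcal{S}\subseteq\mathcal{F}_L^m$: $M_{N,i}^{\mathcal{S}}(t)=\sup_{f\in\mathcal{S},\,\eta\in\mathcal{E}_N}\ \sup_{\tau\ge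 t}|f^{(i)}(\tau)-[\mathcal{D}_i(f+\eta)](\tau)|\in[0,\infty]$. For $T>0$, $\mathcal{G}^m_{L,N}(T)=\{g\in\mathcal{F}_L^m:|g(t)|\le N\text{ for all }t\in[0,T]\}$ and $\bar g^{m,L}_{N,k}(T)=\sup\{g^{(k)}(T):g\in\mathcal{G}^m_{L,N}(T)\}$. A causal differentiator $\mathcal{D}$ of order $m$ is deterministically optimal over $\mathcal{F}_L^m$ if $M_{N,k}^{\mathcal{F}_{L'}^m}(t)\le\bar g_{N,k}^{m,L+L'}(t)$ for all $t>0$, $L'\in[0,L]$, $N\ge0$ and $k\in\{1,\dots,m\}$. Robustness: for $\mathcal{S}\subseteq\mathcal{U}$ and $\epsilon>0$ let $Q^{\mathcal{S}}_{\epsilon,i}(t)=\sup_{u_1\in\mathcal{S},\,\eta\in\mathcal{E}_\epsilon}\ \sup_{\tau\ge t}|[\mathcal{D}_iu_1](\tau)-[\mathcal{D}_i(u_1+\eta)](\tau)|$ and $Q^{\mathcal{S}}_i(t)=\lim_{\epsilon\to0^+}Q^{\mathcal{S}}_{\epsilon,i}(t)$. $\mathcal{D}$ is robust almost from the beginning over $\mathcal{S}$ if $Q_i^{\mathcal{S}}(t)=0$ for all $t>0$ and $i=1,\dots,m$. *)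

(* Defs.v *)
From HB Require Import structures.
From mathcomp Require Import all_boot all_order all_algebra.
From mathcomp Require Import all_classical all_reals all_analysis.
Set Implicit Arguments.
Unset Strict Implicit.
Unset Printing Implicit Defensive.
Import Order.TTheory GRing.Theory Num.Theory.
Import numFieldNormedType.Exports.
Local Open Scope classical_set_scope.
Local Open Scope ring_scope.

(* A signal, mathematically a function on the half-line [0, +oo[, is represented
   by a function R -> R of which only the values at arguments t >= 0 are used.
   A differentiator is likewise a function on all of R -> R; only its values on
   the signals in [signalU] and at times t >= 0 are constrained, and
   causality makes it insensitive to the values of its input at negative times. *)

Section Signals.
Variable R : realType.
Implicit Types (f g h u eta : R -> R) (t theta L N : R) (m k : nat).

(* Differentiation on [0, +oo[, one-sided at 0. *)
Definition hderivable f t : Prop :=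
  if 0 < t then derivable f t 1
  else cvg ((fun s => s^-1 * (f s - f 0)) @ 0^'+).

Definition hderive1 f t : R :=
  if 0 < t then derive1 f t
  else lim ((fun s => s^-1 * (f s - f 0)) @ 0^'+).

Definition hderiven k f : R -> R := iter k hderive1 f.

Definition classF m : set (R -> R) :=
  [set f | [/\ forall k t, (k < m)%N -> 0 <= t -> hderivable (hderiven k f) t,
               {within `[0, +oo[, continuous (hderiven m f)}
             & [lipschitz hderiven m f t | t in `[0, +oo[ ] ]].

(* The almost-everywhere bound on the derivative of order m + 1 includes its
   almost-everywhere existence. *)
Definition classFL m L : set (R -> R) :=
  [set f | classF m f /\
     {ae (@lebesgue_measure R), forall t, 0 <= t ->
        hderivable (hderiven m f) t /\ `|hderiven m.+1 f t| <= L}].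

Definition noiseE N : set (R -> R) :=
  [set eta | forall t, 0 <= t -> `|eta t| <= N].

Definition signalU : set (R -> R) :=
  [set u | exists m L N f eta,
     [/\ 0 <= L, 0 <= N, classFL m L f, noiseE N eta & u = f \+ eta]].

Definition supnorm theta u : \bar R :=
  ereal_sup [set `|u tau|%:E | tau in `[0, theta]].

Definition classG m L N t : set (R -> R) :=
  [set g | classFL m L g /\ forall s, 0 <= s <= t -> `|g s| <= N].

Definition gbar m L N k t : \bar R :=
  ereal_sup [set (hderiven k g t)%:E | g in classG m L N t].

End Signals.

Section Differentiators.
Variables (R : realType) (m : nat).

(* Column i : 'I_m of the row vector D u t is the component of the
   differentiator that estimates the derivative of order i.+1. *)
Definition differentiator : Type := (R -> R) -> R -> 'rV[R]_m.

Implicit Types (D : differentiator) (S : set (R -> R)) (i : 'I_m).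

Definition causal D : Prop :=
  forall t u1 u2, 0 <= t -> signalU u1 -> signalU u2 ->
    (forall s, 0 <= s <= t -> u1 s = u2 s) -> D u1 t = D u2 t.

Definition worst_case_error D S (N : R) i (t : R) : \bar R :=
  ereal_sup
    [set ereal_sup
       [set `|hderiven i.+1 p.1 tau - D (p.1 \+ p.2) tau ord0 i|%:E
         | tau in `[t, +oo[ ]
      | p in S `*` noiseE N].

Definition det_optimal D (L : R) : Prop :=
  forall (t L' N : R) i, 0 < t -> 0 <= L' <= L -> 0 <= N ->
    (worst_case_error D (classFL m L') N i t <= gbar m (L + L')%R N i.+1 t)%E.

Definition robustness_error D S i (t eps : R) : \bar R :=
  ereal_sup
    [set ereal_sup
       [set `|D p.1 tau ord0 i - D (p.1 \+ p.2) tau ord0 i|%:E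
         | tau in `[t, +oo[ ]
      | p in S `*` noiseE eps].

(* robustness_error is monotone in eps, so its limit at 0^'+ always exists; that
   this limit equals 0 is stated as convergence to 0. *)
Definition robust_almost_from_beginning D S : Prop :=
  forall (t : R) i, 0 < t ->
    robustness_error D S i t eps @[eps --> 0^'+] --> 0%E.

End Differentiators.

Section FeasibleInterval.
Variables (R : realType) (m : nat) (L : R).
Implicit Types (u : R -> R) (theta N : R) (k : nat).

Definition consistent u theta N : set (R -> R) :=
  [set h | classFL m L h /\ (supnorm theta (h \- u)%R <= N%:E)%E].

Definition interval_at k u theta N : set R :=
  [set x |
    (ereal_sup [set (hderiven k h theta)%:E | h in consistent u theta N]
       - gbar m (2 * L)%R N k theta <= x%:E)%E /\
    (x%:E <= ereal_inf [set (hderiven k h theta)%:E | h in consistent u theta N]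
       + gbar m (2 * L)%R N k theta)%E].

(* Bounds N admitting no consistent h contribute the whole line. *)
Definition intervalI k u theta : set R :=
  \bigcap_(N in [set N | 0 <= N /\ consistent u theta N !=set0])
    interval_at k u theta N.

Definition midpoint_differentiator : differentiator R m :=
  fun u t => \row_(i < m)
    if 0 < t then (inf (intervalI i.+1 u t) + sup (intervalI i.+1 u t)) / 2
    else 0.

End FeasibleInterval.

(* Main.v *)
(* A real x lies in I_k(u)(t) iff |x - h^(k)(t)| <= gbar^{2L}_N(t) for all N and
   all h in F_L^m that are N-close to u on [0, t]. Two such constraints, from h1
   and h2, are compatible because h1 - h2 lies in the class G for the constants
   2L and N1 + N2, and because gbar is subadditive in N; hence I_k(u)(t) is a
   nonempty compact interval. For the same reason perturbing u by noise of size
   e moves both ends of the interval by at most gbar_e(t), which tends to 0 with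
   e by an interpolation argument of Landau-Kolmogorov type: this is robustness.
   Optimality for the smaller classes F_L'^m is obtained by testing the interval
   of f + eta against f + a g, with g in the class G for the constants L + L'
   and N. Conversely, causality allows one to replace u by a function h
   consistent with it after time t, so that optimality for the class F_L^m gives
   membership in the interval. *)
Require Import Defs.
From HB Require Import structures.
From mathcomp Require Import all_boot all_order all_algebra.
From mathcomp Require Import all_classical all_reals all_analysis.
From mathcomp Require Import measurable_realfun ring lra.
Set Implicit Arguments.
Unset Strict Implicit.
Unset Printing Implicit Defensive.
Import Order.TTheory GRing.Theory Num.Theory.
Import numFieldNormedType.Exports.
Local Open Scope classical_set_scope.
Local Open Scope ring_scope.

(** * One-sided and two-sided derivatives on the half-line *)

Section HalfLineDerivative.
Context {R : realType}.
Implicit Types (f g : R -> R) (t s d : R).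

(** Choosing the filter by the sign of [t] puts the one-sided derivative at 0 and the two-sided one
    elsewhere into a single limit, so that linearity is proved once for both. *)
Definition hfilter t : set_system R := if 0 < t then 0^' else 0^'+.

Global Instance hfilter_proper t : ProperFilter (hfilter t).
Proof. by rewrite /hfilter; case: ifP => _; typeclasses eauto. Qed.

Definition hder f t d : Prop :=
  (fun s => s^-1 * (f (s + t) - f t)) @ hfilter t --> d.

Lemma derivable_hquotE f t : derivable f t 1 =
  cvg ((fun s => s^-1 * (f (s + t) - f t)) @ 0^').
Proof.
rewrite /derivable; set F := (F in cvg (F @ _)).
set G := (G in _ = cvg (G @ _)).
by suff -> : F = G by []; apply/funext => h; rewrite /F /G /= [h%:A]mulr1.
Qed.

Lemma hder_hderivable f t d : 0 <= t -> hder f t d ->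
  hderivable f t /\ hderive1 f t = d.
Proof.
move=> t0; rewrite /hder /hderivable /hderive1 /hfilter.
case: ifPn => [tp fd|]; last first.
  rewrite -leNgt => tle; have -> : t = 0 by apply/eqP; rewrite eq_le tle.
  under eq_fun do rewrite addr0.
  by move=> fd; split; [apply/cvg_ex; exists d|exact/cvg_lim].
split; last exact/cvg_lim.
by rewrite derivable_hquotE; apply/cvg_ex; exists d.
Qed.

Lemma hderivable_hder f t : 0 <= t -> hderivable f t ->
  hder f t (hderive1 f t).
Proof.
move=> t0 ft; suff [d fd] : exists d, hder f t d.
  by have [_ ->] := hder_hderivable t0 fd.
move: ft; rewrite /hder /hderivable /hfilter.
case: ifPn => [tp|].
  by rewrite derivable_hquotE => /cvg_ex[d fd]; exists d.
rewrite -leNgt => tle; have -> : t = 0 by apply/eqP; rewrite eq_le tle.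
move=> /cvg_ex[d fd]; exists d; move: fd.
by under [in X in _ -> X]eq_fun do rewrite addr0.
Qed.

Lemma near_hfilter t : 0 <= t -> \forall s \near hfilter t, 0 <= s + t.
Proof.
rewrite le_eqVlt /hfilter => /orP[/eqP <-|t0].
  by rewrite ltxx; near=> s; rewrite addr0.
rewrite t0; near=> s.
have : `|s| < t by near: s; apply: dnbhs0_lt.
by rewrite ltr_norml => /andP[]; lra.
Unshelve. all: by end_near. Qed.

Lemma hder_ext f g t d : 0 <= t -> (forall s, 0 <= s -> f s = g s) ->
  hder f t d -> hder g t d.
Proof.
move=> t0 fg; apply: cvg_trans; apply: near_eq_cvg.
near=> s; rewrite !fg //; near: s; exact: near_hfilter.
Unshelve. all: by end_near. Qed.

Lemma hder_comb (a b : R) f g t d e : hder f t d -> hder g t e ->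
  hder (fun s => a * f s + b * g s) t (a * d + b * e).
Proof.
move=> fd ge; rewrite /hder.
rewrite (_ : (fun _ => _) = (fun s => a * (s^-1 * (f (s + t) - f t)) +
    b * (s^-1 * (g (s + t) - g t)))); last by apply/funext => s; ring.
by apply: cvgD; apply: cvgMr.
Qed.

(** For [t = 0 < s] the hypothesis is a two-sided limit and the conclusion a right-sided one, which
    is weaker. *)
Lemma hder_shift f t s d : 0 <= t -> 0 <= s ->
  hder f (t + s) d -> hder (fun x => f (x + s)) t d.
Proof.
move=> t0 s0; rewrite /hder; under [in X in _ -> X]eq_fun do rewrite -addrA.
apply: cvg_trans; apply: cvg_app; rewrite /hfilter.
case: ifPn => tp; first by rewrite ltr_wpDr.
case: ifPn => // tsp A [e e0 eA]; exists e => //= x xe x0.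
by apply: eA => //; rewrite gt_eqF.
Qed.

Lemma hder_is_derive f t d : 0 < t -> hder f t d -> is_derive t 1 f d.
Proof.
move=> t0 fd; have [] := hder_hderivable (ltW t0) fd.
rewrite /hderivable /hderive1 t0 => fdiff <-; rewrite derive1E.
exact: derivableP.
Qed.

(** Only growth to the right of [t] is recorded: the continuation argument in [ae_bound_lipschitz]
    moves rightwards. *)
Lemma hder_bound f t d (e : R) : 0 <= t -> 0 < e -> hder f t d ->
  exists2 r, 0 < r &
    forall z, t < z < t + r -> `|f z - f t| <= (`|d| + e) * (z - t).
Proof.
move=> t0 e0 fd.
have fd' : (fun s => s^-1 * (f (s + t) - f t)) @ 0^'+ --> d.
  apply: cvg_trans fd; apply: cvg_app; rewrite /hfilter.
  case: ifPn => // tsp A [r r0 rA]; exists r => //= x xe x0.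
  by apply: rA => //; rewrite gt_eqF.
have /cvgr_dist_le /(_ e e0) [r /= r0 H] := fd'.
exists r => // z /andP[tz zr].
have := H (z - t); rewrite /ball_ /= subrK subr_gt0 => /(_ _ tz) {}H.
have h0 : 0 < z - t by rewrite subr_gt0.
have {}H : `|d - (z - t)^-1 * (f z - f t)| <= e.
  by apply: H; rewrite sub0r normrN gtr0_norm // ltrBlDl.
have -> : f z - f t = ((z - t)^-1 * (f z - f t)) * (z - t).
  by field; rewrite gt_eqF.
rewrite normrM (gtr0_norm h0) ler_pM2r //.
by rewrite -[X in `|X|](subKr d) (le_trans (ler_normB _ _)) // lerD2l.
Qed.

End HalfLineDerivative.

(** * Lipschitz constants from almost everywhere bounds *)

Section LipschitzDerivative.
Context {R : realType}.
Notation mu := (@lebesgue_measure R).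
Implicit Types (f g : R -> R) (t s d a b L K : R).

(** The pushforward of Lebesgue measure under a translation agrees with it on half-open intervals,
    hence everywhere by uniqueness. *)
Lemma negligible_translate (A : set R) s :
  mu.-negligible A -> mu.-negligible [set x | A (x + s)].
Proof.
move=> [B [mB B0 AB]].
pose phi : measurableTypeR R -> measurableTypeR R := fun x => x + s.
have mphi : measurable_fun setT phi.
  apply: continuous_measurable_fun => x.
  by apply: cvgD; [exact: cvg_id|exact: cvg_cst].
exists (phi @^-1` B); split; last by move=> x /AB.
- by rewrite -[X in measurable X]setTI; exact: mphi.
- rewrite -[RHS]B0; suff : pushforward mu phi B = mu B by [].
  apply/esym/lebesgue_measure_unique => //= _ [[x y]] _ <-.
  rewrite /pushforward (_ : phi @^-1` _ = `]x - s, y - s]%classic).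
    rewrite !lebesgue_measure_itv /= !lte_fin ltrD2r; case: ifP => // _.
    by rewrite -!EFinB; congr EFin; ring.
  by apply/seteqP; split => z /=; rewrite /phi !in_itv /= ltrBlDr lerBrDr.
Qed.

(* The exceptional set is covered by an open set U of small measure. Starting
   from a, the increment of f grows at a rate at most L + e outside U, and the
   part of its growth that happens in U is at most K times the measure of U. *)
Lemma ae_bound_lipschitz f K L : 0 <= L ->
  (forall x y, 0 <= x -> 0 <= y -> `|f x - f y| <= K * `|x - y|) ->
  {ae mu, forall t, 0 <= t -> exists2 d, hder f t d & `|d| <= L} ->
  forall x y, 0 <= x -> 0 <= y -> `|f x - f y| <= L * `|x - y|.
Proof.
move=> L0 fK [E [mE E0 EP]].
have K0 : 0 <= K.
  have := le_trans (normr_ge0 _) (fK 1 0 ler01 (lexx 0)).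
  by rewrite subr0 normr1 mulr1.
suff main a b : 0 <= a -> a <= b -> `|f b - f a| <= L * (b - a).
  move=> x y x0 y0; case: (leP x y) => xy.
    by rewrite distrC (distrC x) (@ger0_norm _ (y - x)) ?subr_ge0 // main.
  by rewrite (@ger0_norm _ (x - y)) ?subr_ge0 ?main // ltW.
move=> a0 ab; apply/ler_addgt0Pr => e0 e0_gt0.
(* At [b] the excess over [L * (b - a)] will be at most [e * (b - a) + K * e]; this choice keeps it
   below [e0]. *)
pose e := e0 / (b - a + K + 1).
have den : 0 < b - a + K + 1 by lra.
have e_gt0 : 0 < e by rewrite divr_gt0.
have [U [oU EU Ue]] :
    exists U, [/\ open U, E `<=` U & (mu (U `\` E) < e%:E)%E].
  by apply: lebesgue_regularity_outer => //; rewrite [ltLHS]E0.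
have mU : measurable U by exact: open_measurable.
have {}Ue : (mu U < e%:E)%E.
  have -> : (mu U = mu (U `\` E) + mu (U `&` E))%E by exact: measureDI.
  rewrite [X in (_ + X)%E](_ : _ = 0%E) ?adde0 //.
  by apply: (subset_measure0 _ mE _ E0); [exact: measurableI|].
pose phi x := fine (mu (U `&` `[a, x])).
have mI x : measurable (U `&` `[a, x]) by exact: measurableI.
have phi_le x : (mu (U `&` `[a, x]) <= mu U)%E by exact: measureIl.
have phi_fin x : mu (U `&` `[a, x]) \is a fin_num.
  rewrite ge0_fin_numE //; apply: le_lt_trans (phi_le x) _.
  exact: lt_trans Ue (ltry _).
have phiE x : phi x <= e.
  rewrite -lee_fin fineK //; apply: le_trans (phi_le x) _; exact: ltW.
have phi0 x : 0 <= phi x by exact: fine_ge0.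
have phi_homo x y : x <= y -> phi x <= phi y.
  move=> xy; rewrite fine_le ?phi_fin //.
  apply: le_measure; rewrite ?inE; [exact: mI|exact: mI|].
  by apply: setIS; apply: subset_itvl; rewrite bnd_simp.
have phi_add x y : a <= x -> x <= y -> `]x, y] `<=` U ->
    phi x + (y - x) <= phi y.
  move=> ax xy xyU; rewrite -lee_fin EFinD !fineK //.
  have -> : (y - x)%:E = mu `]x, y]%classic.
    rewrite lebesgue_measure_itv /= lte_fin; case: ltgtP xy => // -> _.
    by rewrite subrr.
  have <- : (mu ((U `&` `[a, x]) `|` `]x, y]) =
      mu (U `&` `[a, x]) + mu `]x, y]%classic)%E.
    apply: measureU; [exact: mI|exact: measurable_itv|].
    apply/seteqP; split => // z [[_]] /=; rewrite !in_itv /=.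
    by move=> /andP[_ zx] /andP[xz _]; move: (lt_le_trans xz zx); rewrite ltxx.
  apply: le_measure; rewrite ?inE;
    [apply: measurableU; [exact: mI|exact: measurable_itv]|exact: mI|].
  move=> z [[Uz /= pq]|/= pq]; split => /=; move: pq;
    rewrite ?in_itv /= => /andP[p q].
  - exact: Uz.
  - by rewrite p (le_trans q).
  - by apply: xyU; rewrite /= in_itv /= p.
  - by rewrite q andbT (le_trans ax) // ltW.
pose P x := `|f x - f a| <= (L + e) * (x - a) + K * phi x.
pose A := [set x | a <= x <= b /\ P x].
have Aa : A a.
  by split; [rewrite lexx|rewrite /P !subrr normr0 mulr0 add0r mulr_ge0].
have ubA : ubound A b by move=> x [/andP[]].
have supA : has_sup A by split; [exists a|exists b].
set s := sup A.
have aS : a <= s by exact: sup_upper_bound.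
have sb : s <= b by apply: ge_sup => //; exists a.
have s0 : 0 <= s by exact: le_trans aS.
(* [P] survives at the supremum: [f] is Lipschitz and [phi] is monotone, so moving from a nearby
   point of [A] to [s] costs arbitrarily little. *)
have Ps : P s.
  apply/ler_addgt0Pr => r r0.
  pose q := r / (K + `|L + e| + 1).
  have qd : 0 < K + `|L + e| + 1 by rewrite ltr_wpDl // addr_ge0.
  have q0 : 0 < q by rewrite divr_gt0.
  have [x [/andP[ax xb] Px] sx] := sup_adherent q0 supA.
  have xs : x <= s by apply: sup_upper_bound => //; split => //; rewrite ax.
  have h1 : `|f s - f x| <= K * (s - x).
    by rewrite -(@ger0_norm _ (s - x)) ?subr_ge0 // fK // (le_trans a0).
  have h2 := ler_wpM2l K0 (phi_homo _ _ xs).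
  have h3 : `|f s - f a| <= `|f s - f x| + `|f x - f a|.
    by rewrite -[f s - f a](subrKA (f x)) ler_normD.
  have h4 : - ((L + e) * (s - x)) <= `|L + e| * (s - x).
    rewrite -mulNr ler_wpM2r ?subr_ge0 //.
    by rewrite (le_trans (ler_norm _)) // normrN.
  have h5 : (K + `|L + e|) * (s - x) <= r.
    have : (K + `|L + e| + 1) * (s - x) <= (K + `|L + e| + 1) * q.
      by rewrite ler_pM2l //; rewrite -/s in sx; lra.
    rewrite [X in _ <= X]mulrC /q divfK ?gt_eqF // => /(le_trans _); apply.
    by rewrite ler_wpM2r ?subr_ge0 // lerDl.
  rewrite /P in Px *; lra.
suff -> : b = s.
  have := Ps; rewrite /P => /le_trans; apply.
  have h1 : K * phi s <= K * e by exact: ler_wpM2l.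
  have h2 : e * (s - a) <= e * (b - a) by rewrite ler_wpM2l ?lerD2r // ltW.
  have h3 : e * (b - a) + K * e <= e0.
    rewrite [leRHS](_ : _ = e * (b - a + K + 1)); last first.
      by rewrite /e divfK // gt_eqF.
    lra.
  lra.
apply/eqP; rewrite eq_le sb andbT leNgt; apply/negP => sltb.
(* If the increments just to the right of [s] obey the rate in [P], then [A] contains points beyond
   its supremum. *)
have step r : 0 < r ->
    (forall z, s < z < s + r ->
      `|f z - f s| <= (L + e) * (z - s) + K * (phi z - phi s)) -> False.
  move=> r0 H; pose z := Num.min b (s + r / 2).
  have sz : s < z by rewrite lt_min sltb ltrDl divr_gt0.
  have zb : z <= b by rewrite ge_min lexx.
  have zr : z < s + r.
    by rewrite /z gt_min; apply/orP; right; rewrite ltrD2l; lra.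
  have Pz : P z.
    have := H z; rewrite sz zr => /(_ isT) Hz.
    have h3 : `|f z - f a| <= `|f z - f s| + `|f s - f a|.
      by rewrite -[f z - f a](subrKA (f s)) ler_normD.
    rewrite /P in Ps *; lra.
  have : z <= s.
    apply: sup_upper_bound => //; split => //; rewrite zb andbT.
    exact: le_trans aS (ltW sz).
  by rewrite leNgt sz.
(* Inside [U] the growth is charged to [phi], which increases by at least [z - s], so the crude
   constant [K] suffices. *)
have [Us|nUs] := pselect (U s).
  have [r /= r0 rU] := (open_nbhs_nbhs (conj oU Us)).
  apply: (step r r0) => z /andP[sz zr].
  have h1 : `|f z - f s| <= K * (z - s).
    by rewrite -(@gtr0_norm _ (z - s)) ?subr_gt0 // fK // (le_trans s0) // ltW.
  have h2 : z - s <= phi z - phi s.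
    rewrite lerBrDl phi_add // ?ltW // => w /=.
    rewrite in_itv /= => /andP[sw wz].
    apply: rU; rewrite /ball /= distrC gtr0_norm ?subr_gt0 // ltrBlDl.
    exact: le_lt_trans zr.
  have h3 := ler_wpM2l K0 h2.
  have h4 : 0 <= (L + e) * (z - s).
    by rewrite mulr_ge0 ?subr_ge0 ?(ltW sz) // addr_ge0 // ltW.
  lra.
(* Outside [U] the point is not exceptional, so the derivative exists there and is bounded by
   [L]. *)
have [d fd dL] : exists2 d, hder f s d & `|d| <= L.
  by apply: contrapT => H; apply: nUs; apply: EU; apply: EP => /(_ s0).
have [r r0 H] := hder_bound s0 e_gt0 fd.
apply: (step r r0) => z /[dup] /H {}H /andP[sz _].
have h1 : (`|d| + e) * (z - s) <= (L + e) * (z - s).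
  by rewrite ler_pM2r ?subr_gt0 // lerD2r.
have h2 : 0 <= K * (phi z - phi s).
  by rewrite mulr_ge0 // subr_ge0 phi_homo // ltW.
lra.
Qed.
End LipschitzDerivative.

(** * Functions together with their derivatives *)

Section Jets.
Context {R : realType}.
Notation mu := (@lebesgue_measure R).
Implicit Types (f g : R -> R) (G H : nat -> R -> R) (t s d a b L K : R).
Implicit Types (m k : nat).

Global Instance lebesgue_ae_filter : Filter (nbhs (almost_everywhere mu)).
Proof. exact: (ae_filter_ringOfSetsType (@lebesgue_measure R)). Qed.

Lemma lipschitz_halflineP f : [lipschitz f t | t in `[0, +oo[%classic] <->
  exists K, forall x y, 0 <= x -> 0 <= y -> `|f x - f y| <= K * `|x - y|.
Proof.
split=> [fl|[K fK]].
  have [K KP] : exists K, K.-lipschitz_(`[0, +oo[) f.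
    near (pinfty_nbhs R) => K; exists K; near: K; exact: fl.
  exists K => x y x0 y0; have := KP (x, y); rewrite /= !in_itv /= !andbT.
  exact.
apply: (@klipschitzW _ _ _ K).
  apply: (@globally_properfilter _ _ (0, 0)).
  by split; rewrite /= in_itv /= lexx.
by move=> [x y] /= []; rewrite !in_itv /= !andbT; exact: fK.
Unshelve. all: by end_near. Qed.

Lemma klipschitz_halfline_continuous f K :
  (forall x y, 0 <= x -> 0 <= y -> `|f x - f y| <= K * `|x - y|) ->
  {within `[0, +oo[, continuous f}.
Proof.
move=> fK; have K0 : 0 <= K.
  have := le_trans (normr_ge0 _) (fK 1 0 ler01 (lexx 0)).
  by rewrite subr0 normr1 mulr1.
apply/subspace_continuousP => x /=; rewrite in_itv /= andbT => x0.
have K1 : 0 < K + 1 by rewrite ltr_wpDl.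
apply/cvgrPdist_le => e e0; near=> y.
have y0 : 0 <= y.
  have : `[0, +oo[%classic y by near: y; exact: withinT.
  by rewrite /= in_itv /= andbT.
apply: le_trans (fK _ _ x0 y0) _.
apply: (@le_trans _ _ ((K + 1) * `|x - y|)).
  by rewrite ler_wpM2r // lerDl.
rewrite -ler_pdivlMl //; near: y; apply: cvg_within.
have d0 : 0 < (K + 1)^-1 * e by apply: mulr_gt0; rewrite ?invr_gt0.
by apply/nbhs_ballP; exists ((K + 1)^-1 * e) => // z; exact: ltW.
Unshelve. all: by end_near. Qed.

(** Carrying all derivatives as a family [G] with a relational derivative spares computing with
    iterated limits, whose values off the half-line are arbitrary. The constant [K] is unspecified;
    [jet_klipschitz] sharpens it to [L]. *)
Definition jet m L G : Prop :=
  [/\ forall k t, (k < m)%N -> 0 <= t -> hder (G k) t (G k.+1 t),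
      exists K, forall x y, 0 <= x -> 0 <= y ->
        `|G m x - G m y| <= K * `|x - y|
    & {ae mu, forall t, 0 <= t -> exists2 d, hder (G m) t d & `|d| <= L}].

Lemma jet_hderiven m L G k t : jet m L G -> (k <= m)%N -> 0 <= t ->
  hderiven k (G 0%N) t = G k t.
Proof.
move=> [GS _ _]; elim: k t => // k IH t km t0.
rewrite /hderiven iterS -/(hderiven k (G 0%N)).
suff /(hder_hderivable t0)[_] : hder (hderiven k (G 0%N)) t (G k.+1 t) by [].
apply: hder_ext (GS _ _ km t0) => // s s0; rewrite IH //; exact: ltnW.
Qed.

Lemma jet_classFL m L G : jet m L G -> classFL m L (G 0%N).
Proof.
move=> JG; have [GS [K GK] Gae] := JG.
have E k t : (k <= m)%N -> 0 <= t -> G k t = hderiven k (G 0%N) t.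
  by move=> km t0; rewrite (jet_hderiven JG).
have EK x y : 0 <= x -> 0 <= y -> `|hderiven m (G 0%N) x -
    hderiven m (G 0%N) y| <= K * `|x - y|.
  by move=> x0 y0; rewrite -!E //; exact: GK.
split; first split.
- move=> k t km t0.
  suff /(hder_hderivable t0)[] : hder (hderiven k (G 0%N)) t (G k.+1 t) by [].
  by apply: hder_ext (GS _ _ km t0) => // s s0; rewrite E // ltnW.
- exact: klipschitz_halfline_continuous EK.
- by apply/lipschitz_halflineP; exists K.
- apply: filterS Gae => t H t0; have [d Gd dL] := H t0.
  have /(hder_hderivable t0)[? e] : hder (hderiven m (G 0%N)) t d.
    by apply: hder_ext Gd => // s s0; rewrite E.
  by split=> //; rewrite /hderiven iterS -/(hderiven m (G 0%N)) e.
Qed.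

Lemma classFL_jet m L f : classFL m L f -> jet m L (fun k => hderiven k f).
Proof.
move=> [[fd _ flip] fae]; split.
- by move=> k t km t0; apply: hderivable_hder => //; exact: fd.
- exact/lipschitz_halflineP.
- apply: filterS fae => t H t0; have [h dL] := H t0.
  by exists (hderiven m.+1 f t) => //; exact: hderivable_hder.
Qed.

Lemma jet_comb m (a b L1 L2 : R) G H : jet m L1 G -> jet m L2 H ->
  jet m (`|a| * L1 + `|b| * L2) (fun k s => a * G k s + b * H k s).
Proof.
move=> [GS [K GK] Gae] [HS [K' HK] Hae]; split.
- by move=> k t km t0; apply: hder_comb; [exact: GS|exact: HS].
- exists (`|a| * K + `|b| * K') => x y x0 y0.
  rewrite (_ : _ - _ = a * (G m x - G m y) + b * (H m x - H m y)); last by ring.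
  rewrite (le_trans (ler_normD _ _)) // !normrM mulrDl -!mulrA.
  by apply: lerD; apply: ler_wpM2l => //; [exact: GK|exact: HK].
- apply: filterS2 Gae Hae => t h1 h2 t0.
  have [d Gd dL] := h1 t0; have [e He eL] := h2 t0.
  exists (a * d + b * e); first exact: hder_comb.
  rewrite (le_trans (ler_normD _ _)) // !normrM.
  by apply: lerD; exact: ler_wpM2l.
Qed.

Lemma jet_shift m L G s : 0 <= s -> jet m L G ->
  jet m L (fun k x => G k (x + s)).
Proof.
move=> s0 [GS [K GK] Gae]; split.
- move=> k t km t0; apply: hder_shift => //; apply: GS => //; exact: addr_ge0.
- exists K => x y x0 y0; rewrite (_ : x - y = (x + s) - (y + s)); last by ring.
  by apply: GK; exact: addr_ge0.
- apply: negligibleS (negligible_translate s Gae) => t /= H h; apply: H => t0.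
  have [d Gd dL] := h (addr_ge0 t0 s0).
  by exists d => //; exact: hder_shift.
Qed.

Lemma jet0 m L : 0 <= L -> jet m L (fun _ _ => 0).
Proof.
have h t : hder (fun=> 0 : R) t 0.
  rewrite /hder (_ : (fun _ => _) = fun=> 0); first exact: cvg_cst.
  by apply/funext => s; rewrite subrr mulr0.
move=> L0; split.
- by [].
- by exists 0 => x y _ _; rewrite subrr normr0 mul0r.
- by apply: nearW => t _; exists 0 => //; rewrite normr0.
Qed.

Lemma jet_klipschitz m L G : 0 <= L -> jet m L G ->
  forall x y, 0 <= x -> 0 <= y -> `|G m x - G m y| <= L * `|x - y|.
Proof. by move=> L0 [_ [K GK] Gae]; exact: ae_bound_lipschitz GK Gae. Qed.

End Jets.

(** * Interpolation between a function and its derivatives *)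

Section LandauKolmogorov.
Context {R : realType}.
Implicit Types (G : nat -> R -> R) (x y c l T L nu eps : R) (m k : nat).

(** With [0 < x] the whole segment lies where derivatives are two-sided, as the mean value theorem
    expects; later bounds therefore hold on intervals open at 0. *)
Lemma jet_MVT m L G k x y : jet m L G -> (k < m)%N -> 0 < x -> x <= y ->
  exists2 z, x <= z <= y & G k y - G k x = G k.+1 z * (y - x).
Proof.
move=> [GS _ _] km x0 xy.
have dG z : x <= z -> is_derive z 1 (G k) (G k.+1 z).
  move=> xz; have z0 := lt_le_trans x0 xz.
  by apply: hder_is_derive => //; apply: GS => //; exact: ltW.
have [||z] := @MVT_segment R (G k) (G k.+1) x y xy.
- by move=> z; rewrite in_itv /= => /andP[/ltW xz _]; exact: dG.
- apply: continuous_in_subspaceT => z; rewrite inE /= in_itv /= => /andP[xz _].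
  have [dz _] := dG z xz.
  exact/differentiable_continuous/derivable1_diffP.
- by rewrite in_itv => zxy E; exists z.
Qed.

(* Split an interval of length l in three: between points of the outer thirds
   where the derivative of order k is small, the mean value theorem gives a
   point where the derivative of order k + 1 is small. *)
Lemma jet_small_point k l : 0 < l -> exists2 C, 0 < C &
  forall m L G c nu, (k <= m)%N -> jet m L G -> 0 < c ->
    (forall x, c <= x <= c + l -> `|G 0%N x| <= nu) ->
    exists2 xi, c <= xi <= c + l & `|G k xi| <= C * nu.
Proof.
elim: k l => [|k IH] l l0.
  exists 1 => // m L G c nu _ _ c0 H; exists c; rewrite ?mul1r ?H //;
    by rewrite lexx lerDl ltW.
have l3 : 0 < l / 3 by rewrite divr_gt0.
have [C C0 HC] := IH _ l3.
(* The two points found are at least [l / 3] apart and the values there differ by at most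
   [2 * (C * nu)]; the quotient gives the factor 6. *)
exists (6 * C / l); first by rewrite divr_gt0 // mulr_gt0.
move=> m L G c nu km JG c0 H.
have [||a ac Ga] := HC m L G c nu (ltnW km) JG.
- by [].
- by move=> x /andP[cx xl]; apply: H; apply/andP; split; lra.
have [||b bc Gb] := HC m L G (c + 2 * (l / 3)) nu (ltnW km) JG.
- by lra.
- by move=> x /andP[cx xl]; apply: H; apply/andP; split; lra.
move: ac bc => /andP[ca ac] /andP[cb bc].
have ab : a <= b by lra.
have [|z /andP[az zb] E] := jet_MVT JG km _ ab; first lra.
exists z; first by apply/andP; split; lra.
have h1 : `|G k.+1 z| * (l / 3) <= 2 * (C * nu).
  apply: (@le_trans _ _ (`|G k.+1 z| * (b - a))).
    by apply: ler_wpM2l => //; lra.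
  have -> : `|G k.+1 z| * (b - a) = `|G k b - G k a|.
    by rewrite E normrM [X in _ = _ * X]ger0_norm // subr_ge0.
  by rewrite (le_trans (ler_normB _ _)) //; lra.
rewrite (_ : 6 * C / l * nu = 6 * C * nu / l); last by ring.
by rewrite ler_pdivlMr //; lra.
Qed.

(** Downward induction from [k = m], with [nu] independent of [G]. A point where the derivative is
    small comes from [jet_small_point]; the Lipschitz constant [L] at the top order, and the bound
    on the next derivative below it, carry the smallness to every other point. *)
Lemma jet_uniform_bound m L T k : 0 <= L -> 0 < T -> (k <= m)%N ->
  forall eps, 0 < eps -> exists2 nu, 0 < nu &
    forall G, jet m L G -> (forall x, 0 <= x <= T -> `|G 0%N x| <= nu) ->
      forall x, 0 < x <= T -> `|G k x| <= eps.
Proof.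
move=> L0 T0.
elim: {k}(m - k)%N {-2}k (erefl (m - k)%N) => [|n IH] k nE km eps e0.
  have {nE km} -> : k = m by apply/eqP; rewrite eqn_leq km -subn_eq0 nE.
  (* A window of length at most [T / 2] fits into the interval to the right or to the left of any
     [x], and [G m] varies by at most [eps / 2] on it. *)
  pose l := Num.min (T / 2) (eps / 2 / (L + 1)).
  have L1 : 0 < L + 1 by lra.
  have l0 : 0 < l by rewrite lt_min !divr_gt0.
  have lT : l <= T / 2 by rewrite ge_min lexx.
  have lL : L * l <= eps / 2.
    have : l * (L + 1) <= eps / 2.
      by rewrite -ler_pdivlMr // ge_min lexx orbT.
    lra.
  have [C C0 HC] := jet_small_point m l0.
  exists (eps / 2 / C); first by rewrite !divr_gt0.
  move=> G JG H x /andP[x0 xT].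
  have [c [c0 cT /andP[cx xc]]] :
      exists c, [/\ 0 < c, c + l <= T & c <= x <= c + l].
    have [xT2|xT2] := leP x (T / 2).
      by exists x; split=> //; rewrite ?lexx; lra.
    by exists (x - l); split; rewrite ?subrK ?lexx ?andbT; lra.
  have [|xi /andP[cxi xic] Gxi] := HC m L G c (eps / 2 / C) (leqnn m) JG c0.
    by move=> y /andP[cy yc]; apply: H; apply/andP; split; lra.
  rewrite mulrC divfK ?gt_eqF // in Gxi.
  have h1 := jet_klipschitz L0 JG (ltW x0) (ltW (lt_le_trans c0 cxi)).
  have h2 : `|x - xi| <= l by rewrite ler_norml; apply/andP; split; lra.
  have h3 := ler_wpM2l L0 h2.
  have h4 : `|G m x| <= `|G m x - G m xi| + `|G m xi|.
    by rewrite -{1}[G m x](subrK (G m xi)) ler_normD.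
  lra.
have km' : (k < m)%N by rewrite -subn_gt0 nE.
have nE' : (m - k.+1)%N = n by rewrite subnS nE.
have [|nu1 nu10 H1] := IH k.+1 nE' km' (eps / 2 / T).
  by rewrite !divr_gt0.
have T2 : 0 < T / 2 by rewrite divr_gt0.
have [C C0 HC] := jet_small_point k T2.
exists (Num.min nu1 (eps / 2 / C)); first by rewrite lt_min nu10 !divr_gt0.
move=> G JG H x /andP[x0 xT].
have Hk1 z : 0 < z <= T -> `|G k.+1 z| <= eps / 2 / T.
  by move=> zT; apply: H1 => // y /H; rewrite le_min => /andP[].
have [|xi /andP[cxi xic] Gxi] := HC m L G (T / 2) (eps / 2 / C) km JG T2.
  move=> y /andP[cy yc]; have : 0 <= y <= T by apply/andP; split; lra.
  by move=> /H; rewrite le_min => /andP[].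
rewrite mulrC divfK ?gt_eqF // in Gxi.
have lip a b : 0 < a -> a <= b -> b <= T ->
    `|G k b - G k a| <= eps / 2.
  move=> a0 ab bT; have [z /andP[az zb] ->] := jet_MVT JG km' a0 ab.
  rewrite normrM (ger0_norm (_ : 0 <= b - a)) ?subr_ge0 //.
  have h1 : `|G k.+1 z| <= eps / 2 / T by apply: Hk1; apply/andP; split; lra.
  have h2 : eps / 2 = eps / 2 / T * T by rewrite divfK // gt_eqF.
  rewrite [leRHS]h2; apply: ler_pM => //; lra.
have h4 : `|G k x| <= `|G k x - G k xi| + `|G k xi|.
  by rewrite -{1}[G k x](subrK (G k xi)) ler_normD.
have h5 : `|G k x - G k xi| <= eps / 2.
  by case: (leP x xi) => xxi; [rewrite distrC|]; apply: lip; lra.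
lra.
Qed.

(** The bound may depend on [G] here; each order is compared with its value at [T], from the top
    order down. *)
Lemma jet_bounded m L T G k : jet m L G -> 0 < T -> (k <= m)%N ->
  exists B, forall x, 0 < x <= T -> `|G k x| <= B.
Proof.
move=> JG T0; elim: {k}(m - k)%N {-2}k (erefl (m - k)%N) => [|n IH] k nE km.
  have {nE km} -> : k = m by apply/eqP; rewrite eqn_leq km -subn_eq0 nE.
  have [_ [K GK] _] := JG.
  exists (`|G m T| + `|K| * T) => x /andP[x0 xT].
  rewrite -[G m x](subrKC (G m T)) (le_trans (ler_normD _ _)) // lerD2l.
  rewrite (le_trans (GK _ _ (ltW x0) (ltW T0))) //.
  apply: (@le_trans _ _ (`|K| * `|x - T|)).
    by rewrite ler_wpM2r // ler_norm.
  by rewrite ler_wpM2l // distrC ger0_norm ?subr_ge0 //; lra.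
have km' : (k < m)%N by rewrite -subn_gt0 nE.
have [|B HB] := IH k.+1 _ km'; first by rewrite subnS nE.
exists (`|G k T| + B * T) => x /andP[x0 xT].
rewrite -[G k x](subKr (G k T)) (le_trans (ler_normB _ _)) // lerD2l.
have [z /andP[xz zT] ->] := jet_MVT JG km' x0 xT.
have Bz : `|G k.+1 z| <= B by rewrite HB // zT andbT (lt_le_trans x0).
by rewrite normrM ler_pM // ger0_norm ?subr_ge0 //; lra.
Qed.

End LandauKolmogorov.

(** * The function gbar *)

Section SignalClasses.
Context {R : realType}.
Implicit Types (f g h : R -> R) (a b c L N s t T eps : R) (m k : nat).

Lemma classFL_comb m (a b L1 L2 : R) f g : classFL m L1 f -> classFL m L2 g ->
  classFL m (`|a| * L1 + `|b| * L2) (fun s => a * f s + b * g s) /\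
  forall k t, (k <= m)%N -> 0 <= t ->
    hderiven k (fun s => a * f s + b * g s) t =
    a * hderiven k f t + b * hderiven k g t.
Proof.
move=> /classFL_jet Jf /classFL_jet Jg; have J := jet_comb a b Jf Jg.
split; first exact: jet_classFL J.
by move=> k t km t0; rewrite -(jet_hderiven J km t0).
Qed.

Lemma classFL_le m L L' f : L <= L' -> classFL m L f -> classFL m L' f.
Proof.
move=> LL' [Cf fae]; split => //; apply: filterS fae => t H t0.
by have [? dL] := H t0; split => //; exact: le_trans LL'.
Qed.

Lemma classFL_scale m (a L : R) f : classFL m L f ->
  classFL m (`|a| * L) (fun s => a * f s) /\
  forall k t, (k <= m)%N -> 0 <= t ->
    hderiven k (fun s => a * f s) t = a * hderiven k f t.
Proof.
move=> Ff; have [] := classFL_comb a 0 Ff Ff.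
rewrite normr0 mul0r addr0 (_ : (fun s => _) = fun s => a * f s); last first.
  by apply/funext => s; rewrite mul0r addr0.
by move=> H1 H2; split => // k t km t0; rewrite H2 // mul0r addr0.
Qed.

Lemma classFL_shift m L s f : 0 <= s -> classFL m L f ->
  classFL m L (fun x => f (x + s)) /\
  forall k t, (k <= m)%N -> 0 <= t ->
    hderiven k (fun x => f (x + s)) t = hderiven k f (t + s).
Proof.
move=> s0 /classFL_jet Jf; have J := jet_shift s0 Jf.
split; first exact: jet_classFL J.
by move=> k t km t0; rewrite -(jet_hderiven J km t0).
Qed.

Lemma classFL0 m L : 0 <= L -> classFL m L (fun=> 0 : R) /\
  forall k t, (k <= m)%N -> 0 <= t -> hderiven k (fun=> 0 : R) t = 0.
Proof.
move=> L0; have J := @jet0 R m L L0.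
split; first exact: jet_classFL J.
by move=> k t km t0; exact: (jet_hderiven J km t0).
Qed.

Lemma classG_le m L L' N N' T g : L <= L' -> N <= N' ->
  classG m L N T g -> classG m L' N' T g.
Proof.
move=> LL' NN' [Fg gN]; split; first exact: classFL_le Fg.
by move=> s /gN /le_trans; apply.
Qed.

Lemma classG_scale m (a L N T : R) g : classG m L N T g ->
  classG m (`|a| * L) (`|a| * N) T (fun s => a * g s).
Proof.
move=> [Fg gN]; have [H _] := classFL_scale a Fg; split => // s sT.
by rewrite normrM ler_wpM2l // gN.
Qed.

Lemma classG_small m L T k : 0 <= L -> 0 < T -> (k <= m)%N ->
  forall eps, 0 < eps -> exists2 nu, 0 < nu &
    forall g, classG m L nu T g -> `|hderiven k g T| <= eps.
Proof.
move=> L0 T0 km eps e0; have [nu nu0 H] := jet_uniform_bound L0 T0 km e0.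
exists nu => // g [/classFL_jet Jg gnu].
by apply: (H _ Jg) => //; rewrite T0 lexx.
Qed.

Lemma gbar_ge0 m L N k T : 0 <= L -> 0 <= N -> 0 <= T -> (k <= m)%N ->
  (0 <= gbar m L N k T)%E.
Proof.
move=> L0 N0 T0 km; have [F0 D0] := classFL0 m L0.
apply: ereal_sup_ubound; exists (fun=> 0); last by rewrite D0.
by split => // s _; rewrite normr0.
Qed.

Lemma gbar_le_small m L T k : 0 <= L -> 0 < T -> (k <= m)%N ->
  forall eps, 0 < eps -> exists2 nu, 0 < nu &
    forall N, N <= nu -> (gbar m L N k T <= eps%:E)%E.
Proof.
move=> L0 T0 km eps e0; have [nu nu0 H] := classG_small L0 T0 km e0.
exists nu => // N Nnu; apply: ge_ereal_sup => _ [g Gg <-].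
rewrite lee_fin (le_trans (ler_norm _)) // H //.
exact: classG_le Gg.
Qed.

(** At some noise level [nu] the derivatives are bounded by 1. For [N > nu], scaling by [nu / N < 1]
    leads into that class, which bounds the supremum by [N / nu]. *)
Lemma gbar_fin_num m L N k T : 0 <= L -> 0 <= N -> 0 < T -> (k <= m)%N ->
  gbar m L N k T \is a fin_num.
Proof.
move=> L0 N0 T0 km; rewrite ge0_fin_numE; last by rewrite gbar_ge0 // ltW.
have [nu nu0 H] := classG_small L0 T0 km ltr01.
have [Nnu|nuN] := leP N nu.
  apply: (@le_lt_trans _ _ 1%:E); last exact: ltry.
  apply: ge_ereal_sup => _ [g Gg <-].
  by rewrite lee_fin (le_trans (ler_norm _)) // H //; exact: classG_le Gg.
have Np : 0 < N by exact: lt_trans nuN.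
apply: (@le_lt_trans _ _ (N / nu)%:E); last exact: ltry.
apply: ge_ereal_sup => _ [g Gg <-]; rewrite lee_fin (le_trans (ler_norm _)) //.
have := classG_scale (nu / N) Gg.
rewrite gtr0_norm ?divr_gt0 // divfK ?gt_eqF // => Gg'.
have [_ D] := classFL_scale (nu / N) Gg.1.
have {Gg'} /H : classG m L nu T (fun s => nu / N * g s).
  by apply: classG_le Gg' => //; rewrite ler_piMl // ler_pdivrMr // mul1r ltW.
rewrite D ?(ltW T0) // normrM gtr0_norm ?divr_gt0 // => h.
by rewrite -[leRHS]mulr1 -ler_pdivrMl ?divr_gt0 // invf_div.
Qed.

(** The class is symmetric under negation, so the supremum of signed values also bounds absolute
    values. *)
Lemma classG_le_gbar m L N k T g : 0 <= L -> 0 <= N -> 0 < T -> (k <= m)%N ->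
  classG m L N T g -> `|hderiven k g T| <= fine (gbar m L N k T).
Proof.
move=> L0 N0 T0 km.
suff H g' : classG m L N T g' -> hderiven k g' T <= fine (gbar m L N k T).
  move=> Gg; rewrite ler_norml H // andbT lerNl.
  have [_ D] := classFL_scale (-1) Gg.1.
  have := classG_scale (-1) Gg; rewrite normrN1 !mul1r => /H.
  by rewrite D ?(ltW T0) // mulN1r.
move=> Gg; rewrite -lee_fin fineK ?gbar_fin_num //.
by apply: ereal_sup_ubound; exists g'.
Qed.

Lemma fine_gbar_le m L N k T c : 0 <= L -> 0 <= N -> 0 < T -> (k <= m)%N ->
  (forall g, classG m L N T g -> hderiven k g T <= c) ->
  fine (gbar m L N k T) <= c.
Proof.
move=> L0 N0 T0 km H; rewrite -lee_fin fineK ?gbar_fin_num //.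
by apply: ge_ereal_sup => _ [g Gg <-]; rewrite lee_fin H.
Qed.

(** Shifting time by [t' - t] discards the initial piece of [g] and keeps the derivative at the end
    point. *)
Lemma gbar_antitone m L N k t t' : (k <= m)%N -> 0 <= t -> t <= t' ->
  (gbar m L N k t' <= gbar m L N k t)%E.
Proof.
move=> km t0 tt'; apply: ge_ereal_sup => _ [g [Fg gN] <-].
have s0 : 0 <= t' - t by rewrite subr_ge0.
have [F' D] := classFL_shift s0 Fg.
apply: ereal_sup_ubound; exists (fun x => g (x + (t' - t))); last first.
  by rewrite D // subrKC.
by split => // x /andP[x0 xt]; apply: gN; apply/andP; split; lra.
Qed.

Lemma classG_scale_le m (c L N : R) k T g : 0 < c -> 0 <= L -> 0 <= N ->
  0 < T -> (k <= m)%N -> classG m (c * L) (c * N) T g ->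
  `|hderiven k g T| <= c * fine (gbar m L N k T).
Proof.
move=> c0 L0 N0 T0 km Gg.
have := classG_scale c^-1 Gg.
rewrite gtr0_norm ?invr_gt0 // !mulKf ?gt_eqF // => Gg'.
have [_ D] := classFL_scale c^-1 Gg.1.
have := classG_le_gbar L0 N0 T0 km Gg'.
by rewrite D ?(ltW T0) // normrM gtr0_norm ?invr_gt0 // ler_pdivrMl.
Qed.

(** Subadditivity in the noise level: write [g] as [la * g + mu * g] with weights proportional to
    [N1] and [N2]. Weights at most 1 do not enlarge the constant [L]. *)
Lemma classG_le_gbarD m L N1 N2 k T g : 0 <= L -> 0 <= N1 -> 0 <= N2 ->
  0 < T -> (k <= m)%N -> classG m L (N1 + N2) T g ->
  `|hderiven k g T| <= fine (gbar m L N1 k T) + fine (gbar m L N2 k T).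
Proof.
move=> L0 N10 N20 T0 km Gg.
have [la [mu [la0 mu0 lamu la1 mu1]]] : exists la mu : R,
    [/\ 0 <= la <= 1, 0 <= mu <= 1, la + mu = 1,
        la * (N1 + N2) <= N1 & mu * (N1 + N2) <= N2].
  have [N0|N0] := eqVneq (N1 + N2) 0.
    (* If both noise levels vanish, the proportions are undefined and any convex weights serve. *)
    by exists 1, 0; rewrite N0 !mulr0 !lexx ler01 addr0; split.
  have Np : 0 < N1 + N2 by rewrite lt0r N0 addr_ge0.
  exists (N1 / (N1 + N2)), (N2 / (N1 + N2)).
  split; [| |by rewrite -mulrDl divff|by rewrite divfK|by rewrite divfK];
    apply/andP; split; rewrite ?divr_ge0 ?(ltW Np) // ler_pdivrMr // mul1r.
    by rewrite lerDl.
  by rewrite lerDr.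
have part (r N : R) : 0 <= r <= 1 -> r * (N1 + N2) <= N -> 0 <= N ->
    r * `|hderiven k g T| <= fine (gbar m L N k T).
  move=> /andP[r0 r1] rN N0.
  have [_ D] := classFL_scale r Gg.1.
  rewrite -{1}(ger0_norm r0) -normrM -D ?(ltW T0) //.
  apply: classG_le_gbar => //; apply: classG_le (classG_scale r Gg).
    by rewrite ger0_norm // ler_piMl.
  by rewrite ger0_norm.
have := lerD (part _ _ la0 la1 N10) (part _ _ mu0 mu1 N20).
by rewrite -mulrDl lamu mul1r.
Qed.

End SignalClasses.

(** * Intersections of intervals *)

Section IntervalIntersection.
Context {R : realType}.
Implicit Types (S : set (R * R)) (x e : R).

(** A pair encodes a closed interval by its centre and radius. *)
Definition common_interval S : set R :=
  [set x | forall p, S p -> `|x - p.1| <= p.2].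

Definition pairwise_meeting S : Prop :=
  forall p q, S p -> S q -> p.1 - q.1 <= p.2 + q.2.

Definition midpoint (A : set R) : R := (inf A + sup A) / 2.

Lemma common_intervalE S x : common_interval S x <->
  forall p, S p -> p.1 - p.2 <= x <= p.1 + p.2.
Proof. by split=> H p /H; rewrite ler_distl. Qed.

Section Bounds.
Variable S : set (R * R).
Hypotheses (S0 : S !=set0) (SS : pairwise_meeting S).

Let lower := sup [set p.1 - p.2 | p in S].
Let upper := inf [set p.1 + p.2 | p in S].

Let le_lower p : S p -> p.1 - p.2 <= lower.
Proof.
move=> Sp; apply: ub_le_sup; last by exists p.
by exists (p.1 + p.2) => _ [q Sq <-]; have := SS Sq Sp; lra.
Qed.

Let ge_upper p : S p -> upper <= p.1 + p.2.
Proof.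
move=> Sp; apply: ge_inf; last by exists p.
by exists (p.1 - p.2) => _ [q Sq <-]; have := SS Sp Sq; lra.
Qed.

Let lower_le x : (forall p, S p -> p.1 - p.2 <= x) -> lower <= x.
Proof.
move=> H; apply: ge_sup => [|_ [p Sp <-]]; last exact: H.
by have [p Sp] := S0; exists (p.1 - p.2); exists p.
Qed.

Let upper_ge x : (forall p, S p -> x <= p.1 + p.2) -> x <= upper.
Proof.
move=> H; apply: lb_le_inf => [|_ [p Sp <-]]; last exact: H.
by have [p Sp] := S0; exists (p.1 + p.2); exists p.
Qed.

(** Helly's theorem on the line: every left end lies below every right end, so the supremum of the
    former is at most the infimum of the latter. The last two clauses, extremality of the ends,
    serve to compare two intersections. *)
Lemma common_interval_itv : exists a b,
  [/\ a <= b, common_interval S = `[a, b]%classic,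
      forall x, (forall p, S p -> p.1 - p.2 <= x) -> a <= x
    & forall x, (forall p, S p -> x <= p.1 + p.2) -> x <= b].
Proof.
have ab : lower <= upper.
  by apply: lower_le => p Sp; apply: upper_ge => q Sq; have := SS Sp Sq; lra.
exists lower, upper; split; [exact: ab| |exact: lower_le|exact: upper_ge].
apply/seteqP; split=> x.
  move=> /common_intervalE H; rewrite /= in_itv /=; apply/andP; split.
    by apply: lower_le => p /H /andP[].
  by apply: upper_ge => p /H /andP[].
rewrite /= in_itv /= => /andP[ax xb]; apply/common_intervalE => p Sp.
by rewrite (le_trans (le_lower Sp)) // (le_trans xb) // ge_upper.
Qed.

End Bounds.

Lemma midpoint_itv (a b : R) : a <= b -> midpoint `[a, b]%classic = (a + b) / 2.
Proof.
move=> ab; rewrite /midpoint; congr (_ / 2).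
by rewrite inf_itv ?sup_itv // bnd_simp.
Qed.

Lemma common_interval_midpoint S : S !=set0 -> pairwise_meeting S ->
  common_interval S (midpoint (common_interval S)).
Proof.
move=> S0 SS; have [a [b [ab -> _ _]]] := common_interval_itv S0 SS.
by rewrite midpoint_itv //= in_itv /=; apply/andP; split; lra.
Qed.

Lemma common_interval_bounded S : S !=set0 -> pairwise_meeting S ->
  bounded_set (common_interval S).
Proof.
move=> S0 SS; have [a [b [ab -> _ _]]] := common_interval_itv S0 SS.
exists (`|a| + `|b|); split; first exact: num_real.
move=> M aM x /=; rewrite in_itv /= => /andP[ax xb].
rewrite (le_trans _ (ltW aM)) // ler_norml; apply/andP; split.
  by have := ler_norm (- a); have := normr_ge0 b; rewrite normrN; lra.
by have := ler_norm b; have := normr_ge0 a; lra.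
Qed.

(** Each interval of one family recurs in the other with the same centre and a radius larger by at
    most [e], so each end of the intersection moves by at most [e], and so does the midpoint. *)
Lemma midpoint_common_interval_dist S S' e :
  S !=set0 -> pairwise_meeting S -> S' !=set0 -> pairwise_meeting S' ->
  (forall c r, S (c, r) -> exists2 r', S' (c, r') & r' <= r + e) ->
  (forall c r, S' (c, r) -> exists2 r', S (c, r') & r' <= r + e) ->
  `|midpoint (common_interval S) - midpoint (common_interval S')| <= e.
Proof.
move=> S0 SS S'0 SS'.
have [a [b [ab E mina maxb]]] := common_interval_itv S0 SS.
have [a' [b' [ab' E' mina' maxb']]] := common_interval_itv S'0 SS'.
have ends (T : set (R * R)) u v : u <= v ->
    common_interval T = `[u, v]%classic ->
    forall c r, T (c, r) -> c - r <= u /\ v <= c + r.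
  move=> uv ET c r Tcr.
  have /common_intervalE/(_ _ Tcr)/andP[? _] : common_interval T u.
    by rewrite ET /= in_itv /= lexx.
  have /common_intervalE/(_ _ Tcr)/andP[_ ?] : common_interval T v.
    by rewrite ET /= in_itv /= lexx uv.
  by [].
move=> HS HS'.
have h1 : a <= a' + e.
  apply: mina => -[c r] /HS[r' /(ends _ _ _ ab' E')[h _]] /=; lra.
have h2 : a' <= a + e.
  apply: mina' => -[c r] /HS'[r' /(ends _ _ _ ab E)[h _]] /=; lra.
have h3 : b' - e <= b.
  apply: maxb => -[c r] /HS[r' /(ends _ _ _ ab' E')[_ h]] /=; lra.
have h4 : b - e <= b'.
  apply: maxb' => -[c r] /HS'[r' /(ends _ _ _ ab E)[_ h]] /=; lra.
by rewrite E E' !midpoint_itv // ler_norml; apply/andP; split; lra.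
Qed.

End IntervalIntersection.

(** * The feasible interval *)

Section OptimalDifferentiation.
Context {R : realType}.
Variables (m : nat) (L : R).
Hypothesis L0 : 0 <= L.
Implicit Types (f g h u eta : R -> R) (t theta N e : R) (k : nat).

Let L20 : 0 <= 2 * L. Proof. by rewrite mulr_ge0. Qed.

Lemma supnorm_leP theta u N : (supnorm theta u <= N%:E)%E <->
  forall s, 0 <= s <= theta -> `|u s| <= N.
Proof.
split=> [H s st|H].
  rewrite -lee_fin (le_trans _ H) //; apply: ereal_sup_ubound.
  by exists s => //=; rewrite in_itv.
apply: ge_ereal_sup => _ [s /= + <-]; rewrite in_itv /= lee_fin; exact: H.
Qed.

Definition bands k u theta : set (R * R) :=
  [set p | exists N h, [/\ 0 <= N, consistent m L u theta N h
    & p = (hderiven k h theta, fine (gbar m (2 * L) N k theta))]].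

(** Since [gbar] is finite it can be moved across the extended-real inequalities; a bound on the
    supremum or infimum over [h] then becomes one band for each [h]. *)
Lemma intervalIE k u theta : 0 < theta -> (k <= m)%N ->
  intervalI m L k u theta = common_interval (bands k u theta).
Proof.
move=> th0 km.
apply/seteqP; split=> [x Ix _ [N [h [N0 ch ->]]] /=|x Bx N [N0 _]].
  have [] := Ix N; first by split => //; exists h.
  have gfin := gbar_fin_num L20 N0 th0 km.
  rewrite leeBlDr // => lo; rewrite -leeBlDr // => hi.
  have {}lo : ((hderiven k h theta)%:E <= x%:E + gbar m (2 * L) N k theta)%E.
    by apply: le_trans lo; apply: ereal_sup_ubound; exists h.
  have {}hi : (x%:E - gbar m (2 * L) N k theta <= (hderiven k h theta)%:E)%E.
    by apply: (le_trans hi); apply: ereal_inf_lbound; exists h.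
  move: lo hi; rewrite -(fineK gfin) -EFinD -EFinB !lee_fin => lo hi.
  by rewrite ler_distl; apply/andP; split; lra.
have gfin := gbar_fin_num L20 N0 th0 km.
have band h : consistent m L u theta N h ->
    `|x - hderiven k h theta| <= fine (gbar m (2 * L) N k theta).
  by move=> ch; apply: (Bx (_, _)); exists N, h.
rewrite /interval_at /= leeBlDr //; split; last rewrite -leeBlDr //.
  apply: ge_ereal_sup => _ [h /band + <-].
  by rewrite -(fineK gfin) -EFinD lee_fin ler_distl /= => /andP[]; lra.
apply: le_ereal_inf_tmp => _ [h /band + <-].
by rewrite -(fineK gfin) -EFinB lee_fin ler_distl /= => /andP[]; lra.
Qed.

Lemma bands_pairwise_meeting k u theta : 0 < theta -> (k <= m)%N ->
  pairwise_meeting (bands k u theta).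
Proof.
move=> th0 km p q [N1 [h1 [N10 [F1 /supnorm_leP u1] ->]]].
move=> [N2 [h2 [N20 [F2 /supnorm_leP u2] ->]]] /=.
have [Fg Dg] := classFL_comb 1 (-1) F1 F2.
have : classG m (2 * L) (N1 + N2) theta (fun s => 1 * h1 s + -1 * h2 s).
  split; first by rewrite normrN1 normr1 !mul1r in Fg; rewrite mulr_natl mulr2n.
  move=> s sth; have := u1 s sth; have := u2 s sth => /= v2 v1.
  have -> : 1 * h1 s + -1 * h2 s = (h1 s - u s) - (h2 s - u s) by ring.
  by rewrite (le_trans (ler_normB _ _)) // lerD.
move=> /(classG_le_gbarD L20 N10 N20 th0 km).
rewrite Dg ?(ltW th0) // mul1r mulN1r; exact: le_trans (ler_norm _).
Qed.

Lemma signalU_bounded u theta : signalU u -> 0 < theta ->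
  exists2 N, 0 <= N & forall s, 0 <= s <= theta -> `|u s| <= N.
Proof.
move=> [m' [L' [N' [f [eta [_ N'0 /classFL_jet Jf etaN ->]]]]]] th0.
have [B HB] := jet_bounded Jf th0 (leq0n m').
(* The value at 0 enters separately because [jet_bounded] covers only positive times. *)
exists (Num.max `|f 0| B + N').
  by rewrite addr_ge0 // le_max normr_ge0.
move=> s /andP[s0 sth]; rewrite (le_trans (ler_normD _ _)) // lerD ?etaN //.
move: s0; rewrite le_eqVlt => /orP[/eqP <-|s0]; first by rewrite le_max lexx.
by rewrite le_max [X in _ || X](HB s) ?orbT // s0.
Qed.

(** A signal is bounded on the horizon, so the zero function is consistent with it at that noise
    level. *)
Lemma bands_neq0 k u theta : signalU u -> 0 < theta -> bands k u theta !=set0.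
Proof.
move=> Uu th0; have [N N0 uN] := signalU_bounded Uu th0.
exists (hderiven k (fun=> 0) theta, fine (gbar m (2 * L) N k theta)).
exists N, (fun=> 0); split => //; split; first by have [] := @classFL0 R m L L0.
by apply/supnorm_leP => s /uN; rewrite /= sub0r normrN.
Qed.

Lemma consistent_ext u1 u2 theta N :
  (forall s, 0 <= s <= theta -> u1 s = u2 s) ->
  consistent m L u1 theta N = consistent m L u2 theta N.
Proof.
move=> E; apply/seteqP; split=> h [Fh /supnorm_leP H]; split => //;
  apply/supnorm_leP => s st /=; have := H s st; rewrite /= E //.
Qed.

(** The factor rescales the derivative constant [L + L'] to [2 * L], and the noise level in the same
    proportion. *)
Lemma gbar_double_scale N L' k t : 0 <= L' < L -> 0 <= N -> 0 < t ->
  (k <= m)%N ->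
  fine (gbar m (2 * L) (2 * L / (L + L') * N) k t) <=
  2 * L / (L + L') * fine (gbar m (L + L') N k t).
Proof.
move=> /andP[L'0 L'L] N0 t0 km.
have LL : 0 < L + L' by lra.
have d0 : 0 < 2 * L / (L + L') by rewrite divr_gt0 //; lra.
apply: fine_gbar_le => // [|g Gg]; first by rewrite mulr_ge0 // ltW.
rewrite (le_trans (ler_norm _)) //.
apply: classG_scale_le => //; first exact: ltW.
by rewrite divfK ?gt_eqF.
Qed.

(* For a function f of class L' < L, the interval of f + eta is probed by the
   functions f + a g, where g ranges over the class G for L + L' and a is
   chosen such that f + a g just belongs to the class L. *)
Lemma intervalI_error f eta L' N k t x : 0 <= L' <= L -> 0 <= N -> 0 < t ->
  (k <= m)%N -> classFL m L' f -> noiseE N eta ->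
  intervalI m L k (f \+ eta) t x ->
  `|hderiven k f t - x| <= fine (gbar m (L + L') N k t).
Proof.
move=> /andP[L'0 L'L] N0 t0 km Ff etaN; rewrite intervalIE // => Ix.
(* For [L' = L] the function [f] is itself consistent with the signal at level [N]. *)
move: L'L; rewrite le_eqVlt => /orP[/eqP L'L|L'L].
  rewrite distrC L'L -[L + L]mulr2n -[L *+ 2]mulr_natl.
  apply: (Ix (_, _)); exists N, f; split => //; split.
    by rewrite -L'L.
  apply/supnorm_leP => s /andP[s0 _] /=.
  by rewrite opprD addrA subrr add0r normrN etaN.
have LL : 0 < L + L' by lra.
(* The value [c] solves [L' + c * (L + L') = L]; the probe is then within [c * N + N = d * N] of the
   signal. *)
pose c := (L - L') / (L + L'); pose d := 2 * L / (L + L').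
have c0 : 0 < c by rewrite divr_gt0 // subr_gt0.
have dc : d = c + 1 by rewrite /d /c; field; rewrite gt_eqF.
have cL : c * (L + L') = L - L' by rewrite /c divfK // gt_eqF.
set g0 := fine _.
have probe a g : `|a| = c -> classG m (L + L') N t g ->
    `|x - (hderiven k f t + a * hderiven k g t)| <= d * g0.
  move=> ac [Fg gN]; have [Fh Dh] := classFL_comb 1 a Ff Fg.
  apply: le_trans (gbar_double_scale _ N0 t0 km); last by rewrite L'0 L'L.
  rewrite -[X in _ - (X + _)]mul1r -Dh ?(ltW t0) //.
  apply: (Ix (_, _)); exists (d * N), (fun s => 1 * f s + a * g s).
  split => //; first by rewrite mulr_ge0 // dc addr_ge0 // ltW.
  split.
    rewrite normr1 mul1r ac cL in Fh.
    by apply: classFL_le Fh; lra.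
  apply/supnorm_leP => s st /=; have /andP[s0 _] := st.
  rewrite (_ : _ - _ = a * g s - eta s); last by ring.
  rewrite (le_trans (ler_normB _ _)) // dc mulrDl mul1r lerD ?etaN //.
  by rewrite normrM ac ler_wpM2l ?gN // ltW.
(* Taking the supremum over [g] gives [c * g0 <= d * g0 - y], and [d = c + 1] leaves [y <= g0]. *)
have bound y : (forall g, classG m (L + L') N t g ->
    c * hderiven k g t <= d * g0 - y) -> y <= g0.
  move=> H; have : g0 <= (d * g0 - y) / c.
    apply: fine_gbar_le => // [|g Gg]; first exact: ltW.
    by rewrite ler_pdivlMr // mulrC H.
  by rewrite ler_pdivlMr // dc; lra.
rewrite ler_distl; apply/andP; split.
  suff : x - hderiven k f t <= g0 by lra.
  apply: bound => g Gg.
  have := probe (- c) g _ Gg; rewrite normrN gtr0_norm // => /(_ erefl).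
  by move=> /(le_trans (ler_norm _)); lra.
suff : hderiven k f t - x <= g0 by lra.
apply: bound => g Gg.
have := probe c g _ Gg; rewrite gtr0_norm // => /(_ erefl).
by rewrite distrC => /(le_trans (ler_norm _)); lra.
Qed.

End OptimalDifferentiation.

(** * Differentiators *)

Section Differentiator.
Context {R : realType}.
Variables (m : nat) (L : R).
Hypothesis L0 : 0 <= L.
Implicit Types (D : differentiator R m) (i : 'I_m) (u : R -> R) (t : R).

Lemma intervalI_det_optimal D :
  (forall u t i, signalU u -> 0 < t -> intervalI m L i.+1 u t (D u t ord0 i)) ->
  det_optimal D L.
Proof.
move=> DI t L' N i t0 /andP[L'0 L'L] N0.
apply: ge_ereal_sup => _ [[f eta] [/= Ff etaN] <-].
apply: ge_ereal_sup => _ [tau /= + <-]; rewrite in_itv /= andbT => ttau.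
have tau0 : 0 < tau by exact: lt_le_trans ttau.
(* Errors at later times [tau] are covered because [gbar] decreases in time. *)
apply: (@le_trans _ _ (gbar m (L + L') N i.+1 tau)); last first.
  by apply: gbar_antitone => //; exact: ltW.
rewrite -(@fineK _ (gbar _ _ _ _ _)); last first.
  by apply: gbar_fin_num => //; exact: addr_ge0.
rewrite lee_fin; apply: (@intervalI_error _ m L L0 f eta L' N i.+1) => //.
- by rewrite L'0.
- by apply: DI => //; exists m, L', N, f, eta.
Qed.

Lemma det_optimal_intervalI D : causal D -> det_optimal D L ->
  forall u t i, signalU u -> 0 < t -> intervalI m L i.+1 u t (D u t ord0 i).
Proof.
move=> cD oD u t i Uu t0; rewrite intervalIE //.
(* The noise [eta] reproduces [u - h] up to [t] and vanishes afterwards, which keeps it bounded by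
   [N] for all times; causality then identifies the outputs for [u] and [h \+ eta] at time [t]. *)
move=> _ [N [h [N0 [Fh /supnorm_leP hu] ->]]] /=.
pose eta s := if s <= t then u s - h s else 0.
have etaN : noiseE N eta.
  move=> s s0; rewrite /eta; case: ifP => st; last by rewrite normr0.
  by rewrite distrC; apply: hu; rewrite s0.
have -> : D u t = D (h \+ eta) t.
  apply: cD => //; [exact: ltW|by exists m, L, N, h, eta|].
  by move=> s /andP[_ st]; rewrite /= /eta st subrKC.
rewrite distrC -lee_fin fineK; last first.
  by apply: gbar_fin_num => //; rewrite mulr_ge0.
have := oD t L N i t0; rewrite L0 lexx mulr_natl mulr2n => /(_ isT N0).
apply: le_trans; apply: le_trans; last first.
  by apply: ereal_sup_ubound; exists (h, eta).
by apply: ereal_sup_ubound; exists t => //=; rewrite in_itv /= lexx.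
Qed.

Lemma midpoint_differentiatorE u t i : 0 < t ->
  midpoint_differentiator m L u t ord0 i =
  midpoint (common_interval (bands m L i.+1 u t)).
Proof. by move=> t0; rewrite mxE t0 -/(midpoint _) intervalIE. Qed.

Lemma midpoint_differentiator_intervalI u t i : signalU u -> 0 < t ->
  intervalI m L i.+1 u t (midpoint_differentiator m L u t ord0 i).
Proof.
move=> Uu t0; rewrite midpoint_differentiatorE // intervalIE //.
by apply: common_interval_midpoint;
  [exact: bands_neq0|apply: bands_pairwise_meeting].
Qed.

Lemma midpoint_differentiator_causal : causal (midpoint_differentiator m L).
Proof.
move=> t u1 u2 t0 _ _ E; apply/rowP => i; rewrite !mxE.
suff -> : intervalI m L i.+1 u1 t = intervalI m L i.+1 u2 t by [].
have C : consistent m L u1 t = consistent m L u2 t.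
  by apply/funext => N; exact: consistent_ext.
by rewrite /intervalI /interval_at C.
Qed.

Lemma midpoint_differentiator_dist u eta t (e : R) i :
  signalU u -> 0 <= e -> noiseE e eta -> 0 < t ->
  `|midpoint_differentiator m L u t ord0 i -
    midpoint_differentiator m L (u \+ eta) t ord0 i| <=
  fine (gbar m (2 * L) e i.+1 t).
Proof.
move=> Uu e0 etae t0; rewrite !midpoint_differentiatorE //.
have Uv : signalU (u \+ eta).
  have [m' [L' [N' [f [w [L'0 N'0 Ff wN ->]]]]]] := Uu.
  exists m', L', (N' + e), f, (w \+ eta); split => //.
  - exact: addr_ge0.
  - by move=> s s0; rewrite (le_trans (ler_normD _ _)) // lerD ?wN ?etae.
  - by apply/funext => s /=; rewrite addrA.
(* A function within [N] of [v] is within [N + e] of [v'], and subadditivity of [gbar] bounds the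
   increase in radius. The relation is symmetric, so this serves both directions. *)
have transfer v v' : (forall s, 0 <= s -> `|v' s - v s| <= e) ->
    forall c r, bands m L i.+1 v t (c, r) ->
    exists2 r', bands m L i.+1 v' t (c, r') &
      r' <= r + fine (gbar m (2 * L) e i.+1 t).
  move=> vv' c r [N [h [N0 [Fh /supnorm_leP hv] [-> ->]]]].
  exists (fine (gbar m (2 * L) (N + e) i.+1 t)).
    exists (N + e), h; split; [exact: addr_ge0| |by []].
    split => //; apply/supnorm_leP => s st /=.
    have /andP[s0 _] := st; have := hv s st; have := vv' s s0 => /= h1 h2.
    have -> : h s - v' s = (h s - v s) - (v' s - v s) by ring.
    by rewrite (le_trans (ler_normB _ _)) // lerD.
  apply: fine_gbar_le => //; [by rewrite mulr_ge0|exact: addr_ge0|].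
  move=> g Gg; apply: le_trans (ler_norm _) _.
  by apply: classG_le_gbarD => //; rewrite mulr_ge0.
apply: midpoint_common_interval_dist.
- exact: bands_neq0.
- exact: bands_pairwise_meeting.
- exact: bands_neq0.
- exact: bands_pairwise_meeting.
- by apply: transfer => s s0; rewrite /= [u s + _]addrC addrK etae.
- by apply: transfer => s s0; rewrite /= opprD addrA subrr add0r normrN etae.
Qed.

Lemma midpoint_differentiator_robust :
  robust_almost_from_beginning (midpoint_differentiator m L) (@signalU R).
Proof.
move=> t i t0; set Q := robustness_error _ _ _ _.
have L20 : 0 <= 2 * L by rewrite mulr_ge0.
have Qle e : 0 <= e -> (Q e <= gbar m (2 * L) e i.+1 t)%E.
  move=> e0; apply: ge_ereal_sup => _ [[u eta] [/= Uu etae] <-].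
  apply: ge_ereal_sup => _ [tau /= + <-]; rewrite in_itv /= andbT => ttau.
  have tau0 : 0 < tau by exact: lt_le_trans ttau.
  apply: (@le_trans _ _ (gbar m (2 * L) e i.+1 tau)); last first.
    by apply: gbar_antitone => //; exact: ltW.
  rewrite -(@fineK _ (gbar _ _ _ _ _)); last exact: gbar_fin_num.
  by rewrite lee_fin midpoint_differentiator_dist.
(* The zero signal with zero noise shows that neither supremum runs over an empty set, where it
   would be minus infinity. *)
have Q0 e : 0 <= e -> (0 <= Q e)%E.
  move=> e0; pose z : R -> R := fun=> 0.
  have zN : noiseE e z by move=> s _; rewrite normr0.
  have Uz : signalU z.
    exists 0, 0, 0, z, z; split => //.
    - by have [] := @classFL0 R 0 0 (lexx 0).
    - by move=> s _; rewrite normr0.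
    - by apply/funext => s /=; rewrite addr0.
  apply: le_trans; last by apply: ereal_sup_ubound; exists (z, z).
  apply: le_trans; last first.
    by apply: ereal_sup_ubound; exists t => //=; rewrite in_itv /= lexx.
  by rewrite lee_fin.
have Qfin e : 0 <= e -> Q e \is a fin_num.
  move=> e0; rewrite ge0_fin_numE ?Q0 //; apply: le_lt_trans (Qle e e0) _.
  by rewrite -ge0_fin_numE ?gbar_ge0 ?gbar_fin_num // ltW.
apply/fine_cvgP; split.
  by near=> e; apply: Qfin; apply: ltW; near: e; exact: nbhs_right_gt.
apply/cvgrPdist_le => r r0.
have [nu nu0 H] := gbar_le_small L20 t0 (ltn_ord i) r0.
near=> e; have e0 : 0 <= e by apply: ltW; near: e; exact: nbhs_right_gt.
rewrite sub0r normrN ger0_norm ?fine_ge0 ?Q0 //.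
rewrite -lee_fin /= fineK ?Qfin //; apply: le_trans (Qle e e0) _.
by apply: H; near: e; exact: nbhs_right_le.
Unshelve. all: by end_near. Qed.

End Differentiator.

Theorem theorem5p17 (R : realType) (m : nat) (L : R) (hm : (0 < m)%N)
  (hL : 0 <= L) :
  [/\ (forall (u : R -> R) (theta : R) (i : 'I_m), signalU u -> 0 < theta ->
         intervalI m L i.+1 u theta !=set0 /\
         bounded_set (intervalI m L i.+1 u theta)),
      (forall D : differentiator R m, causal D ->
         (det_optimal D L <->
          forall (u : R -> R) (t : R) (i : 'I_m), signalU u -> 0 < t ->
            intervalI m L i.+1 u t (D u t ord0 i)))
    & [/\ causal (midpoint_differentiator m L),
          det_optimal (midpoint_differentiator m L) L
        & robust_almost_from_beginning (midpoint_differentiator m L)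
            (@signalU R)]].
Proof.
split.
- move=> u theta i Uu th0; rewrite intervalIE //.
  have B0 := @bands_neq0 R m L hL i.+1 u theta Uu th0.
  have BB := @bands_pairwise_meeting R m L hL i.+1 u theta th0 (ltn_ord i).
  split; last exact: common_interval_bounded.
  by eexists; exact: common_interval_midpoint.
- move=> D cD; split; first exact: det_optimal_intervalI.
  exact: intervalI_det_optimal.
- split; first exact: midpoint_differentiator_causal.
    apply: intervalI_det_optimal => // u t i.
    exact: midpoint_differentiator_intervalI.
  exact: midpoint_differentiator_robust.
Qed.
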